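(* Let $\mathcal L$ be a logic (over team semantics) with a Łoś' Theorem, and let $\Gamma$ be a set of formulas of $\mathcal L$. If every finite subset $\Gamma_0$ of $\Gamma$ is satisfiable, then $\Gamma$ is satisfiable. In particular, $\mathsf{FO}(C)$ is compact (i.e. every set of formulas all of whose finite subsets are satisfiable is itself satisfiable), both with strict and with lax semantics, whenever $C\subseteq\{{=}(\dots),\perp_c,\subseteq,\mid\}$.
   Context: Syntax. Let $\tau$ be a first-order signature. For a set $C\subseteq\{{=}(\dots),\perp_c,\subseteq,\mid\}$ of atoms (dependence, independence, inclusion, exclusion), the $\tau$-formulas of $\mathsf{FO}(C)$ are built from first-order literals $t=t'$, $\neg t=t'$, $R(\vec t)$, $\neg R(\vec t)$ and those of the atoms ${=}(\vec x,y)$, $\vec x\perp_{\vec z}\vec y$, $\vec x\subseteq\vec y$, $\vec x\mid\vec y$ that belong to $C$ (finite tuples of variables; equal lengths for $\subseteq$ and $\mid$), using $\land$, $\vee$, $\exists x$, $\forall x$. Teams. For a $\tau$-structure $\mathcal M$ with domain $M$ and a set $D$ of variables (possibly infinite), an assignment is a map $s\colon D\to M$; a team of $\mathcal M$ with domain $D$ is a set $X$ of assignments $D\to M$. A logic over team semantics interprets formulas by a relation $\mathcal M\models_X\phi$ between structures $\mathcal M$ with teams $X$ and formulas $\phi$. $s(a/x)$ maps $x$ to $a$ and agrees with $s$ elsewhere. For $F\colon X\to\wp(M)\setminus\{\emptyset\}$, $X(F/x)=\{s(a/x)\mid s\in X,\ a\in F(s)\}$; and $X(M/x)=\{s(a/x)\mid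 s\in X,\ a\in M\}$. Semantics of $\mathsf{FO}(C)$. - First-order literals hold in $(\mathcal M,X)$ iff every $s\in X$ satisfies them in the Tarskian sense. - $\mathcal M\models_X{=}(\vec x,y)$ iff for all $s,s'\in X$, $s(\vec x)=s'(\vec x)$ implies $s(y)=s'(y)$. - $\mathcal M\models_X\vec x\subseteq\vec y$ iff for all $s\in X$ there is $s'\in X$ with $s(\vec x)=s'(\vec y)$. - $\mathcal M\models_X\vec x\perp_{\vec z}\vec y$ iff for all $s,s'\in X$ with $s(\vec z)=s'(\vec z)$ there is $s''\in X$ with $s''(\vec x\vec z)=s(\vec x\vec z)$ and $s''(\vec y)=s'(\vec y)$. - $\mathcal M\models_X\vec x\mid\vec y$ iff $s(\vec x)\neq s'(\vec y)$ for all $s,s'\in X$. - $\mathcal M\models_X\psi\land\chi$ iff $\mathcal M\models_X\psi$ and $\mathcal M\models_X\chi$. - $\mathcal M\models_X\forall x\,\psi$ iff $\mathcal M\models_{X(M/x)}\psi$. - Lax semantics: $\mathcal M\models_X\psi\vee\chi$ iff there are $Y,Z\subseteq X$ with $Y\cup Z=X$, $\mathcal M\models_Y\psi$, $\mathcal M\models_Z\chi$; $\mathcal M\models_X\exists x\,\psi$ iff $\mathcal M\models_{X(F/x)}\psi$ for some $F\colon X\to\wp(M)\setminus\{\emptyset\}$. - Strict semantics: as lax, but additionally $Y\cap Z=\emptyset$ is required in the clause for disjunction, and in the clause for $\exists$ each $F(s)$ is required to be a singleton. Satisfiability. $\mathcal M\models_X\Gamma$ means $\mathcal M\models_X\phi$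 for all $\phi\in\Gamma$ (where $\mathrm{dom}(X)$ contains all free variables of $\Gamma$). $\Gamma$ is satisfiable if there are a structure $\mathcal M$ and a nonempty team $X$ of $\mathcal M$ with $\mathcal M\models_X\Gamma$. Ultraproducts. Let $\mathcal U$ be an ultrafilter on a set $I$ and $\mathcal M_i$ ($i\in I$) $\tau$-structures with usual ultraproduct $\prod_i\mathcal M_i/\mathcal U$. Given $s_i\colon D\to\mathcal M_i$, $(s_i)_{i\in I}/\mathcal U$ is the assignment $x\mapsto(s_i(x))_{i\in I}/\mathcal U$. For teams $X_i$ of $\mathcal M_i$ with common domain $D$, $\prod_iX_i/\mathcal U$ is the set of all assignments $s\colon D\to\prod_i\mathcal M_i/\mathcal U$ for which there are $s_i\colon D\to\mathcal M_i$ with $s=(s_i)_{i\in I}/\mathcal U$ and $\{i\in I\mid s_i\in X_i\}\in\mathcal U$. Łoś' Theorem. A logic $\mathcal L$ has a Łoś' Theorem if: for every set $I$, $\tau$-structures $\mathcal M_i$ and teams $X_i$ of $\mathcal M_i$ with a shared domain $D$ ($i\in I$), and ultrafilter $\mathcal U$ on $I$, writing $\mathcal M=\prod_i\mathcal M_i/\mathcal U$ and $X=\prod_iX_i/\mathcal U$, for every $\tau$-formula $\phi$ of $\mathcal L$ whose free variables are contained in $D$, $\{i\in I\mid\mathcal M_i\models_{X_i}\phi\}\in\mathcal U$ implies $\mathcal M\models_X\phi$.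
   Formalization: For a general logic, satisfiability of Γ and of its finite subsets is by teams with one common domain D (false if domains vary); for strict FO(C), team domains may contain variables beyond the set in which Γ is written (false if Γ uses all variables of a fixed infinite set). *)

(* Defs.v *)
From Stdlib Require List.
From mathcomp Require Import all_boot.
From mathcomp Require Import boolp classical_sets functions cardinality filter.

Set Implicit Arguments.
Unset Strict Implicit.
Unset Printing Implicit Defensive.

Local Open Scope classical_set_scope.

Record signature := Signature {
  fun_sym : Type;
  fun_ar : fun_sym -> nat;
  rel_sym : Type;
  rel_ar : rel_sym -> nat }.

Record structure (tau : signature) := Structure {
  carrier :> Type;
  carrier_inhabited : inhabited carrier;
  fun_interp : forall f : fun_sym tau, ('I_(fun_ar f) -> carrier) -> carrier;
  rel_interp : forall r : rel_sym tau, ('I_(rel_ar r) -> carrier) -> Prop }.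

Lemma structure_point tau (M : structure tau) : exists _ : M, True.
Proof. by case: (carrier_inhabited M) => a; exists a. Qed.

Definition default tau (M : structure tau) : M := projT1 (cid (structure_point M)).

(* A team with domain [D] is a set of maps [D -> M], where [D : set V] is
   coerced to the type of its elements.  The domain is part of the type, so the
   empty team also has a domain. *)
Definition assignment tau V (D : set V) (M : structure tau) := D -> M.
Definition team tau V (D : set V) (M : structure tau) := set (assignment D M).

(* The value of [s] at a variable.  The value [default M] outside [D] is never
   used when the free variables of the formula lie in [D]. *)
Definition value tau V (D : set V) (M : structure tau) (s : assignment D M)
    (x : V) : M :=
  match pselect (D x) with
  | left Dx => s (SigSub (mem_set Dx))
  | right _ => default M
  end.
Arguments value {tau V D M} s x.

(* s(a/x) *)
Definition upd tau V (D : set V) (M : structure tau) (s : assignment D M)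
    (x : V) (a : M) : assignment (D `|` [set x]) M :=
  fun y => if pselect (val y = x) then a else value s (val y).
Arguments upd {tau V D M} s x a.

(* X(F/x); only the values of [F] on [X] matter. *)
Definition team_supp tau V (D : set V) (M : structure tau) (X : team D M)
    (F : assignment D M -> set M) (x : V) : team (D `|` [set x]) M :=
  [set t | exists s a, [/\ X s, F s a & t = upd s x a]].
Arguments team_supp {tau V D M} X F x.

(* X(M/x) *)
Definition team_dupl tau V (D : set V) (M : structure tau) (X : team D M)
    (x : V) : team (D `|` [set x]) M :=
  [set t | exists s a, X s /\ t = upd s x a].
Arguments team_dupl {tau V D M} X x.

(* A logic over team semantics, with variables from [V]. *)
Record team_logic (tau : signature) (V : Type) := TeamLogic {
  form : Type;
  free : form -> set V;
  sat : forall (M : structure tau) (D : set V), team D M -> form -> Prop }.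

Section Ultraproduct.
Variables (tau : signature) (I : Type) (U : set_system I).
Variable M : I -> structure tau.

Definition uclass (f : forall i, M i) : set (forall i, M i) :=
  [set g | U [set i | f i = g i]].

Definition uprod_carrier := {A : set (forall i, M i) | exists f, A = uclass f}.

Definition umk (f : forall i, M i) : uprod_carrier :=
  exist _ (uclass f) (ex_intro _ f erefl).

Definition urep (A : uprod_carrier) : forall i, M i := projT1 (cid (svalP A)).

Lemma uprod_inhabited : inhabited uprod_carrier.
Proof. by constructor; apply: umk => i; exact: default. Qed.

(* The interpretations are computed on chosen representatives; since [U] is a
   filter, they do not depend on the choice. *)
Definition uprod : structure tau := @Structure tau uprod_carrier uprod_inhabited
  (fun f args => umk (fun i => @fun_interp _ (M i) f (fun k => urep (args k) i)))
  (fun r args => U [set i | @rel_interp _ (M i) r (fun k => urep (args k) i)]).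

Definition uassign V (D : set V) (s : forall i, assignment D (M i)) :
    assignment D uprod :=
  fun x => umk (fun i => s i x).

Definition uteam V (D : set V) (X : forall i, team D (M i)) : team D uprod :=
  [set s | exists si : forall i, assignment D (M i),
     s = uassign si /\ U [set i | X i (si i)]].

End Ultraproduct.

Arguments uclass {tau I} U {M} f _.
Arguments umk {tau I} U {M} f.
Arguments uassign {tau I} U {M V D} s x.
Arguments uteam {tau I} U {M V D} X _.

Definition has_los tau V (L : team_logic tau V) : Prop :=
  forall (I : Type) (U : set_system I), UltraFilter U ->
  forall (M : I -> structure tau) (D : set V) (X : forall i, team D (M i))
    (phi : form L),
  free phi `<=` D -> U [set i | sat (X i) phi] -> sat (uteam U X) phi.

(* Satisfiability by a nonempty team whose domain is exactly [D].  For an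
   arbitrary logic, compactness only makes sense relative to a common domain:
   formulas phi_n without free variables, true of a team iff its domain is finite
   with at least n elements, satisfy Los' Theorem and are finitely satisfiable
   when the domain may vary with the finite subset, but not satisfiable. *)
Definition satisfiable_on tau V (L : team_logic tau V) (D : set V)
    (Gamma : set (form L)) : Prop :=
  (forall phi, Gamma phi -> free phi `<=` D) /\
  exists (M : structure tau) (X : team D M),
    X !=set0 /\ forall phi, Gamma phi -> sat X phi.

Definition satisfiable tau V (L : team_logic tau V) (Gamma : set (form L)) :
    Prop :=
  exists D : set V, satisfiable_on D Gamma.

Definition compact_for (F : Type) (S : set F -> Prop) : Prop :=
  forall Gamma : set F,
    (forall Gamma0, finite_set Gamma0 -> Gamma0 `<=` Gamma -> S Gamma0) ->
    S Gamma.

Variant atom := Dependence | Independence | Inclusion | Exclusion.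

Section FO.
Variable tau : signature.

Inductive term (V : Type) :=
| Var (x : V)
| App (f : fun_sym tau) (ts : 'I_(fun_ar f) -> term V).

(* The tau-formulas of FO(C) with variables from [V]; an atom outside [C] cannot
   be formed.  [Ind _ xs zs ys] is the atom that [xs] is independent of [ys]
   given [zs]. *)
Inductive formula (C : set atom) (V : Type) :=
| Eq (t u : term V)
| Neq (t u : term V)
| Rel (r : rel_sym tau) (ts : 'I_(rel_ar r) -> term V)
| Nrel (r : rel_sym tau) (ts : 'I_(rel_ar r) -> term V)
| Dep (_ : C Dependence) (xs : seq V) (y : V)
| Ind (_ : C Independence) (xs zs ys : seq V)
| Inc (_ : C Inclusion) n (xs ys : n.-tuple V)
| Exc (_ : C Exclusion) n (xs ys : n.-tuple V)
| And (phi psi : formula C V)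
| Or (phi psi : formula C V)
| Ex (x : V) (phi : formula C V)
| All (x : V) (phi : formula C V).

Fixpoint term_vars V (t : term V) : set V :=
  match t with
  | Var x => [set x]
  | App f ts => [set x | exists k, term_vars (ts k) x]
  end.

Definition seq_vars V (xs : seq V) : set V := [set x | List.In x xs].

Fixpoint fo_free C V (phi : formula C V) : set V :=
  match phi with
  | Eq t u | Neq t u => term_vars t `|` term_vars u
  | Rel _ ts | Nrel _ ts => [set x | exists k, term_vars (ts k) x]
  | Dep _ xs y => seq_vars xs `|` [set y]
  | Ind _ xs zs ys => seq_vars xs `|` seq_vars zs `|` seq_vars ys
  | Inc _ _ xs ys | Exc _ _ xs ys => seq_vars xs `|` seq_vars ys
  | And psi chi | Or psi chi => fo_free psi `|` fo_free chi
  | Ex x psi | All x psi => fo_free psi `\ x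
  end.

Fixpoint eval V (M : structure tau) (e : V -> M) (t : term V) : M :=
  match t with
  | Var x => e x
  | App f ts => fun_interp (fun k => eval e (ts k))
  end.

Variant semantics := Lax | Strict.

Fixpoint fo_sat C V (m : semantics) (M : structure tau) (phi : formula C V) :
    forall D : set V, team D M -> Prop :=
  match phi with
  | Eq t u => fun D X => forall s, X s -> eval (value s) t = eval (value s) u
  | Neq t u => fun D X => forall s, X s -> eval (value s) t <> eval (value s) u
  | Rel r ts => fun D X => forall s, X s ->
      rel_interp (fun k => eval (value s) (ts k))
  | Nrel r ts => fun D X => forall s, X s ->
      ~ rel_interp (fun k => eval (value s) (ts k))
  | Dep _ xs y => fun D X => forall s s', X s -> X s' ->
      map (value s) xs = map (value s') xs -> value s y = value s' y
  | Ind _ xs zs ys => fun D X => forall s s', X s -> X s' ->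
      map (value s) zs = map (value s') zs ->
      exists s'', [/\ X s'',
        map (value s'') (xs ++ zs) = map (value s) (xs ++ zs) &
        map (value s'') ys = map (value s') ys]
  | Inc _ _ xs ys => fun D X => forall s, X s ->
      exists2 s', X s' & map (value s) xs = map (value s') ys
  | Exc _ _ xs ys => fun D X => forall s s', X s -> X s' ->
      map (value s) xs <> map (value s') ys
  | And psi chi => fun D X => fo_sat m psi X /\ fo_sat m chi X
  | Or psi chi => fun D X => exists Y Z : team D M,
      [/\ Y `|` Z = X, m = Strict -> Y `&` Z = set0,
          fo_sat m psi Y & fo_sat m chi Z]
  | Ex x psi => fun D X => exists F : assignment D M -> set M,
      [/\ forall s, X s -> F s !=set0,
          m = Strict -> forall s, X s -> exists a, F s = [set a] &
          fo_sat m psi (team_supp X F x)]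
  | All x psi => fun D X => fo_sat m psi (team_dupl X x)
  end.

Definition FO (C : set atom) (m : semantics) (V : Type) : team_logic tau V :=
  TeamLogic (@fo_free C V) (fun M D X phi => @fo_sat C V m M phi D X).

Fixpoint term_rename V V' (r : V -> V') (t : term V) : term V' :=
  match t with
  | Var x => Var (r x)
  | App f ts => App (fun k => term_rename r (ts k))
  end.

Fixpoint rename C V V' (r : V -> V') (phi : formula C V) : formula C V' :=
  match phi with
  | Eq t u => Eq C (term_rename r t) (term_rename r u)
  | Neq t u => Neq C (term_rename r t) (term_rename r u)
  | Rel R ts => Rel C (fun k => term_rename r (ts k))
  | Nrel R ts => Nrel C (fun k => term_rename r (ts k))
  | Dep c xs y => Dep c (map r xs) (r y)
  | Ind c xs zs ys => Ind c (map r xs) (map r zs) (map r ys)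
  | Inc c _ xs ys => Inc c (map_tuple r xs) (map_tuple r ys)
  | Exc c _ xs ys => Exc c (map_tuple r xs) (map_tuple r ys)
  | And psi chi => And (rename r psi) (rename r chi)
  | Or psi chi => Or (rename r psi) (rename r chi)
  | Ex x psi => Ex (r x) (rename r psi)
  | All x psi => All (r x) (rename r psi)
  end.

(* Satisfiability when the supply of variables is not limited to those the
   formulas are written in: the domain of the team may contain variables outside
   [V].  This matters for strict semantics, which is not local, so that a set of
   formulas mentioning every element of [V] can be satisfiable only by teams
   with further variables in their domain. *)
Definition satisfiable_unbounded (C : set atom) (m : semantics) (V : Type)
    (Gamma : set (formula C V)) : Prop :=
  exists (V' : Type) (r : V -> V'),
    injective r /\ satisfiable (L := FO C m V') (rename r @` Gamma).

End FO.

(* Main.v *)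
Require Import Defs.
From mathcomp Require Import all_boot.
From mathcomp Require Import boolp classical_sets functions cardinality filter.

(** For an arbitrary logic with a Łoś theorem, compactness is the ultraproduct
    argument: index models by the finite subsets of Gamma, take an ultrafilter
    containing every cone [{B | A included in B}], and observe that each
    formula of Gamma holds on a cone, hence in the ultraproduct of the teams;
    the classes of chosen members show that this team is not empty
    ([los_compact]).

    FO(C) with lax semantics has a Łoś theorem ([lax_los]).  The atoms compare
    finitely many values at a time, and finitely many equalities between
    classes are decided together on a set of the ultrafilter.  The connectives
    are existential statements about teams, and their witnesses can be chosen
    in almost every factor and glued, because the ultraproduct of teams
    commutes with unions, supplementation and duplication.

    This gluing breaks down for strict disjunction: two families of
    assignments that differ in every factor may have the same class, each
    variable separating them only on a small set of indices, so the
    ultraproduct of disjoint teams need not be disjoint.  Strict satisfiability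
    is therefore reduced to lax satisfiability.  A strict witness is a lax one
    and lax semantics does not see variables that do not occur
    ([sat_lax_of_rename]), so strict satisfiability over any supply of
    variables yields lax satisfiability by a team on exactly V.  Conversely,
    add countably many fresh variables and let them take all values: each
    assignment [t] then occurs in as many copies as there are sequences
    [nat -> M].  If M has two elements a and b, the copies whose sequence
    starts with a, and those whose sequence starts with b, are again indexed
    by all sequences.  So the copies of an assignment in both sides of a lax
    split can be divided between the sides, and the values of a lax choice
    function can be distributed over the copies, one value per copy and
    without running out of copies ([sat_strict_fat]).  If M is a singleton, a
    team is empty or full, and empty teams satisfy everything
    ([sat_strict_subsingleton]). *)

Set Implicit Arguments.
Unset Strict Implicit.
Unset Printing Implicit Defensive.

Local Open Scope classical_set_scope.

(** Simultaneous choice of witnesses where they exist; in the ultraproduct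
    argument witnesses exist only for almost all indices. *)
Lemma choose_when_possible (I : Type) (T : I -> Type)
    (P : forall i, T i -> Prop) :
  (forall i, inhabited (T i)) ->
  exists f : forall i, T i, forall i, (exists a, P i a) -> P i (f i).
Proof.
move=> T0.
have H i : exists a : T i, (exists b, P i b) -> P i a.
  have [[a Pa]|nP] := pselect (exists a, P i a); first by exists a.
  by case: (T0 i) => a; exists a.
by exists (fun i => projT1 (cid (H i))) => i; apply: (projT2 (cid (H i))).
Qed.

(** * Compactness from Łoś *)

Lemma los_compact (tau : signature) (V : Type) (L : team_logic tau V) :
  has_los L -> forall D : set V, compact_for (satisfiable_on (L := L) D).
Proof.
move=> los D Gamma fin_sat.
pose I := {A : set (form L) | finite_set A /\ A `<=` Gamma}.
have sub_free phi : Gamma phi -> free phi `<=` D.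
  move=> Gphi; have [||free_D _] := fin_sat [set phi].
  - exact: finite_set1.
  - by move=> _ ->.
  - exact: free_D.
split=> //.
have /choice[N HN] : forall i : I, exists N : {M : structure tau & team D M},
    projT2 N !=set0 /\ forall phi, sval i phi -> sat (projT2 N) phi.
  move=> [A [finA AG]] /=.
  by have [_ [M [X HX]]] := fin_sat A finA AG; exists (existT _ M X).
(* The filter generated by the cones, which has the finite intersection
   property because a union of two finite sets is finite. *)
pose up : set_system I := [set P | exists A : I,
  forall B : I, sval A `<=` sval B -> P B].
have up_proper : ProperFilter up.
  apply: Build_ProperFilter_ex; first by move=> P [A HA]; exists A; apply: HA.
  split.
  - exists (exist _ set0 (conj (finite_set0 _) (@sub0set _ Gamma))) => B _.
    by [].
  - move=> P Q [[A [finA AG]] HP] [[B [finB BG]] HQ].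
    have finAB : finite_set (A `|` B) by rewrite finite_setU.
    have ABG : A `|` B `<=` Gamma by rewrite subUset.
    exists (exist _ (A `|` B) (conj finAB ABG)) => C /= ABC; split.
    + by apply: HP => x Ax; apply: ABC; left.
    + by apply: HQ => x Bx; apply: ABC; right.
  - by move=> P Q PQ [A HA]; exists A => B AB; apply/PQ/HA.
have [U [UU upU]] := ultraFilterLemma up_proper.
exists (uprod U (fun i => projT1 (N i))), (uteam U (fun i => projT2 (N i))).
split.
- pose s i := projT1 (cid (HN i).1).
  exists (uassign U s), s; split=> //; apply: filterE => i.
  exact: (projT2 (cid (HN i).1)).
- move=> phi Gphi; apply: los; first exact: sub_free.
  apply: upU.
  have phiG : [set phi] `<=` Gamma by move=> _ ->.
  exists (exist _ [set phi] (conj (finite_set1 phi) phiG)) => B /= phiB.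
  by apply: (HN B).2; apply: phiB.
Qed.

(** * Assignments *)

Section Assignments.
Variables (tau : signature) (M : structure tau).

Lemma value_in V (D : set V) (s : assignment D M) (y : D) :
  value s (val y) = s y.
Proof.
rewrite /value; case: pselect => [Dy|nDy]; last first.
  by case: nDy; exact: (set_mem (valP y)).
by congr s; apply: val_inj.
Qed.

Lemma value_out V (D : set V) (s : assignment D M) x :
  ~ D x -> value s x = default M.
Proof. by rewrite /value; case: pselect. Qed.

Lemma value_inj V (D : set V) (s s' : assignment D M) :
  (forall x, value s x = value s' x) -> s = s'.
Proof. by move=> ss'; apply: funext => y; rewrite -!value_in. Qed.

Lemma value_upd V (D : set V) (s : assignment D M) x a :
  value (upd s x a) x = a.
Proof.
have Dx : (D `|` [set x]) x by right.
have := value_in (upd s x a) (SigSub (mem_set Dx)).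
by rewrite /upd /= => ->; case: pselect.
Qed.

Lemma value_upd_neq V (D : set V) (s : assignment D M) x a y :
  y <> x -> value (upd s x a) y = value s y.
Proof.
move=> yx; have [Dy|nDy] := pselect ((D `|` [set x]) y).
  have := value_in (upd s x a) (SigSub (mem_set Dy)).
  by rewrite /upd /= => ->; case: pselect.
by rewrite !value_out // => Dy; apply: nDy; left.
Qed.

(** On the full domain every map is the value of an assignment, so no default
    value interferes. *)
Lemma value_total V (e : V -> M) x :
  value ((fun y => e (val y)) : assignment [set: V] M) x = e x.
Proof. by rewrite /value; case: pselect => //; case. Qed.

End Assignments.

(** * Teams agreeing along an injection of variables *)

Section Agreement.
Variables (tau : signature) (M : structure tau).
Variables (V V' : Type) (r : V -> V').

(** Agreement of the values at all variables, not only at those of [D]: outside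
    the domains both values are the default of [M], and this form survives
    updates without any condition relating [D'] and [D]. *)
Definition agree (D' : set V') (D : set V) (s : assignment D' M)
    (t : assignment D M) :=
  forall x, value s (r x) = value t x.

(** [Y] is the set of restrictions along [r] of the assignments in [X]; the
    latter may differ also in variables outside the range of [r]. *)
Definition similar (D' : set V') (D : set V) (X : team D' M) (Y : team D M) :=
  (forall s, X s -> exists2 t, Y t & agree s t) /\
  (forall t, Y t -> exists2 s, X s & agree s t).

Lemma agree_upd (D' : set V') (D : set V) (s : assignment D' M)
    (t : assignment D M) x a :
  injective r -> agree s t -> agree (upd s (r x) a) (upd t x a).
Proof.
move=> r_inj st y; have [->|yx] := pselect (y = x); first by rewrite !value_upd.
by rewrite !value_upd_neq // => /r_inj.
Qed.

Lemma agree_uniq (D' : set V') (D : set V) (s : assignment D' M)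
    (t t' : assignment D M) : agree s t -> agree s t' -> t = t'.
Proof. by move=> st st'; apply: value_inj => x; rewrite -st -st'. Qed.

Lemma eval_agree (D' : set V') (D : set V) (s : assignment D' M)
    (t : assignment D M) (u : term tau V) :
  agree s t -> eval (value s) (term_rename r u) = eval (value t) u.
Proof.
move=> st; elim: u => [x|f ts IH] /=; first exact: st.
by congr fun_interp; apply: funext.
Qed.

Lemma evals_agree (D' : set V') (D : set V) (s : assignment D' M)
    (t : assignment D M) n (us : 'I_n -> term tau V) :
  agree s t -> (fun k => eval (value s) (term_rename r (us k))) =
    (fun k => eval (value t) (us k)).
Proof. by move=> st; apply: funext => k; apply: eval_agree. Qed.

Lemma map_agree (D' : set V') (D : set V) (s : assignment D' M)
    (t : assignment D M) (xs : seq V) :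
  agree s t -> map (value s) (map r xs) = map (value t) xs.
Proof. by move=> st; rewrite -map_comp; apply: eq_map => x /=. Qed.

Definition atomic C W (phi : formula tau C W) :=
  match phi with
  | And _ _ | Or _ _ | Ex _ _ | All _ _ => False
  | _ => True
  end.

(** An atom only depends on the set of value tuples at its own variables. *)
Lemma sat_atomic C m m' (phi : formula tau C V) (D' : set V') (D : set V)
    (X : team D' M) (Y : team D M) :
  similar X Y -> atomic phi -> fo_sat m (rename r phi) X <-> fo_sat m' phi Y.
Proof.
move=> [XY YX]; case: phi => //=.
- move=> t u _; split=> H s.
    by move/YX=> [s' /H + ss']; rewrite !(eval_agree _ ss').
  by move/XY=> [s' /H + ss']; rewrite !(eval_agree _ ss').
- move=> t u _; split=> H s.
    by move/YX=> [s' /H + ss']; rewrite !(eval_agree _ ss').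
  by move/XY=> [s' /H + ss']; rewrite !(eval_agree _ ss').
- move=> R ts _; split=> H s.
    by move/YX=> [s' /H + ss']; rewrite (evals_agree _ ss').
  by move/XY=> [s' /H + ss']; rewrite (evals_agree _ ss').
- move=> R ts _; split=> H s.
    by move/YX=> [s' /H + ss']; rewrite (evals_agree _ ss').
  by move/XY=> [s' /H + ss']; rewrite (evals_agree _ ss').
- move=> _ xs y _; split=> H s s'.
    move=> /YX[t Xt ts] /YX[t' Xt' ts'] E.
    rewrite -ts -ts'; apply: H => //.
    by rewrite !(map_agree _ ts, map_agree _ ts').
  move=> /XY[t Xt ts] /XY[t' Xt' ts'].
  rewrite !(map_agree _ ts, map_agree _ ts') ts ts'; exact: H.
- move=> _ xs zs ys _; split=> H s s'.
    move=> /YX[t Xt ts] /YX[t' Xt' ts'] E.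
    have [|t'' [Xt'']] := H t t' Xt Xt'.
      by rewrite !(map_agree _ ts, map_agree _ ts').
    have [s'' Ys'' ts''] := XY _ Xt''.
    rewrite -map_cat !(map_agree _ ts, map_agree _ ts', map_agree _ ts'').
    by exists s''.
  move=> /XY[t Xt ts] /XY[t' Xt' ts'].
  rewrite !(map_agree _ ts, map_agree _ ts') => E.
  have [t'' [Xt'']] := H t t' Xt Xt' E.
  have [s'' Ys'' ts''] := YX _ Xt''.
  exists s''; split=> //.
    by rewrite -map_cat !(map_agree _ ts, map_agree _ ts'').
  by rewrite !(map_agree _ ts'').
- move=> _ n xs ys _; split=> H s.
    move=> /YX[t /H[t' /XY[s' Ys' ts'] E] ts]; exists s' => //.
    by move: E; rewrite (map_agree _ ts) (map_agree _ ts').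
  move=> /XY[t /H[t' /YX[s' Ys' ts'] E] ts]; exists s' => //.
  by rewrite (map_agree _ ts) (map_agree _ ts').
- move=> _ n xs ys _; split=> H s s'.
    move=> /YX[t /H Ht ts] /YX[t' /Ht + ts'].
    by rewrite (map_agree _ ts) (map_agree _ ts').
  move=> /XY[t /H Ht ts] /XY[t' /Ht + ts'].
  by rewrite (map_agree _ ts) (map_agree _ ts').
Qed.

Lemma similar_dupl (D' : set V') (D : set V) (X : team D' M) (Y : team D M) x :
  injective r -> similar X Y -> similar (team_dupl X (r x)) (team_dupl Y x).
Proof.
move=> r_inj [XY YX]; split=> _ [s [a [Hs ->]]].
  have [t Yt st] := XY s Hs; exists (upd t x a); last exact: agree_upd.
  by exists t, a.
have [t Xt ts] := YX s Hs; exists (upd t (r x) a); last exact: agree_upd.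
by exists t, a.
Qed.

(** Locality of lax semantics: a lax split of [Y] puts [t] on every side that
    contains some assignment restricting to [t], and a lax choice for [t]
    collects the choices for all of these.  Both may merge several strict
    witnesses, so a strict witness for [X] suffices as well. *)
Lemma sat_lax_of_rename C m (phi : formula tau C V) (D' : set V') (D : set V)
    (X : team D' M) (Y : team D M) :
  injective r -> similar X Y -> fo_sat m (rename r phi) X -> fo_sat Lax phi Y.
Proof.
move=> r_inj.
elim: phi D' D X Y; try by [move=> *; eapply sat_atomic;
    [eassumption|exact: I|eassumption]].
- move=> psi IH1 chi IH2 D' D X Y XY /= [H1 H2].
  by split; [apply: IH1 H1|apply: IH2 H2].
- move=> psi IH1 chi IH2 D' D X Y [XY YX] /= [X1 [X2 [X12 _ H1 H2]]].
  have sub1 s : X1 s -> X s by move=> ?; rewrite -X12; left.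
  have sub2 s : X2 s -> X s by move=> ?; rewrite -X12; right.
  have sim Z : (forall s, Z s -> X s) ->
      similar Z [set t | Y t /\ exists2 s, Z s & agree s t].
    move=> ZX; split=> [s Zs|t [_ //]].
    by have [t Yt st] := XY s (ZX s Zs); exists t => //; split=> //; exists s.
  exists [set t | Y t /\ exists2 s, X1 s & agree s t].
  exists [set t | Y t /\ exists2 s, X2 s & agree s t]; split=> //.
  - apply/seteqP; split=> [t [] [] //|t Yt].
    have [s] := YX t Yt; rewrite -X12 => -[Xs|Xs] st.
      by left; split=> //; exists s.
    by right; split=> //; exists s.
  - exact: IH1 (sim _ sub1) H1.
  - exact: IH2 (sim _ sub2) H2.
- move=> x psi IH D' D X Y [XY YX] /= [F [F0 _ H]].
  exists (fun t => [set a | exists s, [/\ X s, agree s t & F s a]]).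
  split=> // [t Yt|].
    have [s Xs st] := YX t Yt; have [a Fa] := F0 s Xs.
    by exists a, s.
  apply: IH H; split=> [_ [s [a [Xs Fa ->]]]|_ [t [a [Yt [s [Xs st Fa] ->]]]]].
    have [t Yt st] := XY s Xs; exists (upd t x a); last exact: agree_upd.
    by exists t, a; split=> //; exists s.
  by exists (upd s (r x) a); [exists s, a|apply: agree_upd].
- move=> x psi IH D' D X Y XY /=; apply: IH; exact: similar_dupl.
Qed.

End Agreement.

Lemma term_rename_id (tau : signature) V (t : term tau V) :
  term_rename id t = t.
Proof. by elim: t => //= f ts IH; congr App; apply: funext. Qed.

Lemma rename_id (tau : signature) (C : set atom) V (phi : formula tau C V) :
  rename id phi = phi.
Proof.
have ids (n : nat) (xs : n.-tuple V) : map_tuple id xs = xs.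
  by apply: val_inj; rewrite /= map_id.
elim: phi => /=.
- by move=> t u; rewrite !term_rename_id.
- by move=> t u; rewrite !term_rename_id.
- by move=> R ts; congr Rel; apply: funext => k; rewrite term_rename_id.
- by move=> R ts; congr Nrel; apply: funext => k; rewrite term_rename_id.
- by move=> c xs y; rewrite map_id.
- by move=> c xs zs ys; rewrite !map_id.
- by move=> c n xs ys; rewrite !ids.
- by move=> c n xs ys; rewrite !ids.
- by move=> psi -> chi ->.
- by move=> psi -> chi ->.
- by move=> x psi ->.
- by move=> x psi ->.
Qed.

(** * Łoś' theorem for lax semantics *)

Section Los.
Variables (tau : signature) (I : Type) (U : set_system I).
Hypothesis UU : UltraFilter U.
Variable M : I -> structure tau.

Lemma umk_eq (f g : forall i, M i) :
  umk U f = umk U g <-> U [set i | f i = g i].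
Proof.
split=> [/(congr1 sval)/= fg|fg].
  have : uclass U g g by apply: filterE.
  by rewrite -fg.
have E : uclass U f = uclass U g.
  by apply/seteqP; split=> h fh; apply: filterS2 fg fh => i /= -> ->.
rewrite /umk; move: (ex_intro _ f _); rewrite E => p.
by congr exist; apply: Prop_irrelevance.
Qed.

Lemma umk_urep (A : uprod_carrier U M) : umk U (urep A) = A.
Proof.
case: A => A p; rewrite /urep; case: cid => f /= Af; subst A.
by congr exist; apply: Prop_irrelevance.
Qed.

(** The representatives used to interpret symbols of arity [n] are almost
    everywhere the given ones; here finiteness of arities enters. *)
Lemma urep_umk n (f : 'I_n -> forall i, M i) :
  U [set i | forall k, urep (umk U (f k)) i = f k i].
Proof.
by apply: filter_forall => k; apply/umk_eq; rewrite umk_urep.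
Qed.

Lemma eval_uprod V (e : V -> uprod U M) (ei : forall i, V -> M i)
    (t : term tau V) :
  (forall x, term_vars t x -> e x = umk U (fun i => ei i x)) ->
  eval e t = umk U (fun i => eval (ei i) t).
Proof.
elim: t => [x|f ts IH] /= He; first exact: He.
have {}IH k : eval e (ts k) = umk U (fun i => eval (ei i) (ts k)).
  by apply: IH => x xk; apply: He; exists k.
apply/umk_eq.
apply: filterS (urep_umk (fun k i => eval (ei i) (ts k))) => i /= E.
by congr fun_interp; apply: funext => k; rewrite IH E.
Qed.

Lemma rel_uprod (R : rel_sym tau) (a : 'I_(rel_ar R) -> uprod U M)
    (f : 'I_(rel_ar R) -> forall i, M i) :
  (forall k, a k = umk U (f k)) ->
  rel_interp a <-> U [set i | rel_interp (fun k => f k i)].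
Proof.
move=> /funext ->; have E := urep_umk f.
by split=> H; apply: filterS2 E H => i /= /funext ->.
Qed.

Lemma uassign_eq V (D : set V) (s t : forall i, assignment D (M i)) :
  U [set i | s i = t i] -> uassign U s = uassign U t.
Proof.
move=> st; apply: funext => y; apply/umk_eq.
by apply: filterS st => i /= ->.
Qed.

Section Teams.
Variables (V : Type) (D : set V).

Lemma value_uassign (s : forall i, assignment D (M i)) x :
  D x -> value (uassign U s) x = umk U (fun i => value (s i) x).
Proof. by rewrite /value => Dx; case: pselect. Qed.

Lemma eval_uassign (s : forall i, assignment D (M i)) (t : term tau V) :
  term_vars t `<=` D ->
  eval (value (uassign U s)) t = umk U (fun i => eval (value (s i)) t).
Proof. by move=> tD; apply: eval_uprod => x /tD; apply: value_uassign. Qed.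

Lemma map_uassign (s t : forall i, assignment D (M i)) (xs ys : seq V) :
  seq_vars xs `<=` D -> seq_vars ys `<=` D ->
  map (value (uassign U s)) xs = map (value (uassign U t)) ys <->
  U [set i | map (value (s i)) xs = map (value (t i)) ys].
Proof.
elim: xs ys => [|x xs IH] [|y ys] xD yD /=.
- by split=> // _; apply: filterE.
- by split=> // /filter_ex[].
- by split=> // /filter_ex[].
have {}IH := IH ys (fun z zxs => xD z (or_intror zxs))
  (fun z zys => yD z (or_intror zys)).
have Dx : D x by apply: xD; left.
have Dy : D y by apply: yD; left.
rewrite !value_uassign //; split=> [E|H].
  have /umk_eq xy := congr1 (head (default (uprod U M))) E.
  have /IH xys := congr1 behead E.
  by apply: filterS2 xy xys => i /= -> ->.
congr cons; first by apply/umk_eq; apply: filterS H => i [].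
by apply/IH; apply: filterS H => i [].
Qed.

Lemma upd_uassign (s : forall i, assignment D (M i)) x (a : forall i, M i) :
  upd (uassign U s) x (umk U a) = uassign U (fun i => upd (s i) x (a i)).
Proof.
apply: funext => -[y Dy]; rewrite /upd /uassign /=.
case: pselect => // nyx; rewrite value_uassign //.
by case: (set_mem Dy).
Qed.

Lemma uteam_dupl (X : forall i, team D (M i)) x :
  team_dupl (uteam U X) x = uteam U (fun i => team_dupl (X i) x).
Proof.
apply/seteqP; split=> [_ [_ [a [[s [-> Xs]] ->]]]|_ [t [-> Xt]]].
  exists (fun i => upd (s i) x (urep a i)).
  rewrite -upd_uassign umk_urep; split=> //.
  by apply: filterS Xs => i Xs; exists (s i), (urep a i).
have [i|sa Hsa] := @choose_when_possible _
  (fun i => assignment D (M i) * M i)%type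
  (fun i sa => X i sa.1 /\ t i = upd sa.1 x sa.2).
  exact: inhabits ((fun=> default (M i)), default (M i)).
have {}Xt : U [set i | X i (sa i).1 /\ t i = upd (sa i).1 x (sa i).2].
  by apply: filterS Xt => i [s [a H]]; apply: Hsa; exists (s, a).
exists (uassign U (fun i => (sa i).1)), (umk U (fun i => (sa i).2)); split.
  by exists (fun i => (sa i).1); split=> //; apply: filterS Xt => i [].
rewrite upd_uassign; apply: uassign_eq.
by apply: filterS Xt => i [].
Qed.

(** The supplementing function on the ultraproduct has to collect values over
    all families with the given class: two such families may differ in every
    factor, and then the [F i] may offer them different values. *)
Lemma uteam_supp (X : forall i, team D (M i))
    (F : forall i, assignment D (M i) -> set (M i)) x :
  team_supp (uteam U X) (fun s => [set a | exists si ai,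
    [/\ s = uassign U si, a = umk U ai &
        U [set i | X i (si i) /\ F i (si i) (ai i)]]]) x =
  uteam U (fun i => team_supp (X i) (F i) x).
Proof.
apply/seteqP; split=> [_ [_ [_ [_ [s [a [-> -> XF]]] ->]]]|_ [t [-> Xt]]].
  exists (fun i => upd (s i) x (a i)); rewrite upd_uassign; split=> //.
  by apply: filterS XF => i [Xs Fa]; exists (s i), (a i).
have [i|sa Hsa] := @choose_when_possible _
  (fun i => assignment D (M i) * M i)%type
  (fun i sa => [/\ X i sa.1, F i sa.1 sa.2 & t i = upd sa.1 x sa.2]).
  exact: inhabits ((fun=> default (M i)), default (M i)).
have {}Xt : U [set i | [/\ X i (sa i).1, F i (sa i).1 (sa i).2 &
    t i = upd (sa i).1 x (sa i).2]].
  by apply: filterS Xt => i [s [a H]]; apply: Hsa; exists (s, a).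
exists (uassign U (fun i => (sa i).1)), (umk U (fun i => (sa i).2)); split.
- by exists (fun i => (sa i).1); split=> //; apply: filterS Xt => i [].
- exists (fun i => (sa i).1), (fun i => (sa i).2); split=> //.
  by apply: filterS Xt => i [].
- rewrite upd_uassign; apply: uassign_eq.
  by apply: filterS Xt => i [].
Qed.

(** An ultrafilter containing a union contains one of the two sets, so a family
    in the union almost everywhere is almost everywhere in the same team. *)
Lemma uteamU (X Y : forall i, team D (M i)) :
  uteam U X `|` uteam U Y = uteam U (fun i => X i `|` Y i).
Proof.
apply/seteqP; split=> [_ [[s [-> H]]|[s [-> H]]]|_ [s [-> H]]].
- by exists s; split=> //; apply: filterS H => i; left.
- by exists s; split=> //; apply: filterS H => i; right.
have [HX|HX] := in_ultra_setVsetC [set i | X i (s i)] UU.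
  by left; exists s.
by right; exists s; split=> //; apply: filterS2 H HX => i [].
Qed.

Lemma uteam_eq (X Y : forall i, team D (M i)) :
  U [set i | X i = Y i] -> uteam U X = uteam U Y.
Proof.
move=> XY; apply/seteqP; split=> _ [s [-> H]]; exists s; split=> //.
  by apply: filterS2 XY H => i /= ->.
by apply: filterS2 XY H => i /= ->.
Qed.

End Teams.
End Los.

(** Negated literals and exclusion atoms are preserved because a proper filter
    cannot contain both a set of factors where they hold and one where they
    fail; inclusion and independence atoms, disjunctions and existential
    quantifiers are transferred by gluing witnesses. *)
Lemma lax_los (tau : signature) (C : set atom) (V : Type) :
  has_los (FO tau C Lax V).
Proof.
move=> I U UU M D X phi /=.
elim: phi D X => /=.
- move=> t u D X; rewrite subUset => -[tD uD] H _ [s [-> Xs]].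
  rewrite !eval_uassign //; apply/umk_eq.
  by apply: filterS2 H Xs => i /= + Xs => /(_ _ Xs).
- move=> t u D X; rewrite subUset => -[tD uD] H _ [s [-> Xs]].
  rewrite !eval_uassign // => /umk_eq E.
  apply: (filter_not_empty U).
  by apply: filterS3 H Xs E => i /= Hi /Hi.
- move=> R ts D X tD H _ [s [-> Xs]].
  have E k : eval (value (uassign U s)) (ts k) =
      umk U (fun i => eval (value (s i)) (ts k)).
    by apply: eval_uassign => // x xk; apply: tD; exists k.
  by apply/(rel_uprod UU E); apply: filterS2 H Xs => i /= + Xs => /(_ _ Xs).
- move=> R ts D X tD H _ [s [-> Xs]].
  have E k : eval (value (uassign U s)) (ts k) =
      umk U (fun i => eval (value (s i)) (ts k)).
    by apply: eval_uassign => // x xk; apply: tD; exists k.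
  move/(rel_uprod UU E) => {}E.
  apply: (filter_not_empty U).
  by apply: filterS3 H Xs E => i /= Hi /Hi.
- move=> _ xs y D X; rewrite subUset => -[xD yD] H.
  move=> _ _ [s [-> Xs]] [s' [-> Xs']].
  have Dy : D y by apply: yD.
  move/map_uassign => /(_ xD xD) E.
  rewrite !value_uassign //; apply/umk_eq.
  apply: filterS3 H (filterI Xs Xs') E => i /= Hi [Xi Xi'].
  exact: Hi.
- move=> _ xs zs ys D X; rewrite !subUset => -[[xD zD] yD] H.
  move=> _ _ [s [-> Xs]] [s' [-> Xs']] /map_uassign => /(_ zD zD) E.
  have [i|t Ht] := @choose_when_possible _ (fun i => assignment D (M i))
    (fun i t => [/\ X i t,
      map (value t) (xs ++ zs) = map (value (s i)) (xs ++ zs) &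
      map (value t) ys = map (value (s' i)) ys]).
    exact: inhabits (fun=> default (M i)).
  have G : U [set i | [/\ X i (t i), map (value (t i)) (xs ++ zs) =
          map (value (s i)) (xs ++ zs) &
        map (value (t i)) ys = map (value (s' i)) ys]].
    apply: filterS3 H (filterI Xs Xs') E => i /= Hi [Xi Xi'] Ei.
    exact/Ht/Hi.
  have xzD : seq_vars (xs ++ zs) `<=` D.
    by move=> x /(@List.in_app_or _ _ _ _)[/xD|/zD].
  exists (uassign U t); split.
  + by exists t; split=> //; apply: filterS G => i [].
  + by apply/map_uassign => //; apply: filterS G => i [].
  + by apply/map_uassign => //; apply: filterS G => i [].
- move=> _ n xs ys D X; rewrite subUset => -[xD yD] H _ [s [-> Xs]].
  have [i|t Ht] := @choose_when_possible _ (fun i => assignment D (M i))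
    (fun i t => X i t /\ map (value (s i)) xs = map (value t) ys).
    exact: inhabits (fun=> default (M i)).
  have G : U [set i | X i (t i) /\ map (value (s i)) xs = map (value (t i)) ys].
    by apply: filterS2 H Xs => i /= Hi /Hi[s' ? ?]; apply: Ht; exists s'.
  exists (uassign U t); first by exists t; split=> //; apply: filterS G => i [].
  by apply/map_uassign => //; apply: filterS G => i [].
- move=> _ n xs ys D X; rewrite subUset => -[xD yD] H.
  move=> _ _ [s [-> Xs]] [s' [-> Xs']] /map_uassign => /(_ xD yD) E.
  apply: (filter_not_empty U).
  apply: filterS3 H (filterI Xs Xs') E => i /= Hi [Xi Xi'].
  exact: Hi.
- move=> psi IH1 chi IH2 D X; rewrite subUset => -[psiD chiD] H.
  by split; [apply: IH1|apply: IH2] => //; apply: filterS H => i [].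
- move=> psi IH1 chi IH2 D X; rewrite subUset => -[psiD chiD] H.
  have [i|YZ HYZ] := @choose_when_possible _
    (fun i => team D (M i) * team D (M i))%type
    (fun i YZ => [/\ YZ.1 `|` YZ.2 = X i, fo_sat Lax psi YZ.1 &
      fo_sat Lax chi YZ.2]).
    exact: inhabits (set0, set0).
  have {}H : U [set i | [/\ (YZ i).1 `|` (YZ i).2 = X i,
      fo_sat Lax psi (YZ i).1 & fo_sat Lax chi (YZ i).2]].
    by apply: filterS H => i [Y [Z [? _ ? ?]]]; apply: HYZ; exists (Y, Z).
  exists (uteam U (fun i => (YZ i).1)), (uteam U (fun i => (YZ i).2)).
  split=> //.
  + by rewrite uteamU //; apply: uteam_eq => //; apply: filterS H => i [].
  + by apply: IH1 => //; apply: filterS H => i [].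
  + by apply: IH2 => //; apply: filterS H => i [].
- move=> x psi IH D X psiD H.
  have {}psiD : fo_free psi `<=` D `|` [set x].
    move=> y fy; have [->|nyx] := pselect (y = x); first by right.
    by left; apply: psiD.
  have [i|F HF] := @choose_when_possible _
    (fun i => assignment D (M i) -> set (M i))
    (fun i F => (forall s, X i s -> F s !=set0) /\
      fo_sat Lax psi (team_supp (X i) F x)).
    exact: inhabits (fun=> set0).
  have {}H : U [set i | (forall s, X i s -> F i s !=set0) /\
      fo_sat Lax psi (team_supp (X i) (F i) x)].
    by apply: filterS H => i [G [? _ ?]]; apply: HF; exists G.
  exists (fun s => [set a | exists si ai, [/\ s = uassign U si, a = umk U ai &
        U [set i | X i (si i) /\ F i (si i) (ai i)]]]).
  split=> // [_ [s [-> Xs]]|].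
    have [i|a Ha] := @choose_when_possible _ M (fun i => F i (s i)).
      exact: carrier_inhabited.
    exists (umk U a), s, a; split=> //.
    by apply: filterS2 H Xs => i [Hi _] Xi; split=> //; apply/Ha/Hi.
  rewrite uteam_supp; apply: IH => //.
  by apply: filterS H => i [].
- move=> x psi IH D X psiD H.
  rewrite uteam_dupl; apply: IH => // y fy.
  have [->|nyx] := pselect (y = x); first by right.
  by left; apply: psiD.
Qed.

(** * From lax to strict semantics *)

Section FatTeams.
Variables (tau : signature) (M : structure tau) (V : Type).

(** Splitting a sequence into head and tail makes [nat -> M] equinumerous with
    [M * (nat -> M)], which is all that is needed to divide copies. *)
Definition prepend (a : M) (k : nat -> M) : nat -> M :=
  fun n => if n is n'.+1 then k n' else a.

Lemma prepend_inj a b k k' : prepend a k = prepend b k' -> a = b /\ k = k'.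
Proof.
move=> E; split; first exact: (congr1 (fun f => f 0%N) E).
by apply: funext => n; apply: (congr1 (fun f => f n.+1) E).
Qed.

(** The last condition says that the copies are separated by the fresh
    variables [inr n] alone.  Being distinct would not be enough: quantifying
    over some [inl x] overwrites its value and could merge them. *)
Definition copies (D' : set (V + nat)) (D : set V) (X : team D' M)
    (t : assignment D M) (j : (nat -> M) -> assignment D' M) :=
  [/\ forall k, X (j k), forall k, agree inl (j k) t &
    forall k k', (forall n, value (j k) (inr n) = value (j k') (inr n)) ->
      k = k'].

(** [X] may contain more than the chosen copies: splitting and quantifying
    single out a smaller family of copies, and the others stay in the team. *)
Definition fat (D' : set (V + nat)) (D : set V) (X : team D' M)
    (Y : team D M) :=
  (forall s, X s -> exists2 t, Y t & agree inl s t) /\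
  (forall t, Y t -> exists j, copies X t j).

Lemma inl_inj : injective (@inl V nat).
Proof. by move=> x y []. Qed.

Lemma copies_inj D' D (X : team D' M) (t : assignment D M) j a b k k' :
  copies X t j -> j (prepend a k) = j (prepend b k') -> a = b.
Proof.
move=> [_ _ fresh] E.
by have /prepend_inj[] := fresh _ _ (fun n => congr1 (value^~ (inr n)) E).
Qed.

Lemma copies_prepend D' D (X X1 : team D' M) (t : assignment D M) j a :
  copies X t j -> (forall k, X1 (j (prepend a k))) ->
  copies X1 t (fun k => j (prepend a k)).
Proof. by move=> [_ jt fresh] X1j; split=> // k k' /fresh /prepend_inj[]. Qed.

Lemma copies_upd D' D x a (X : team D' M)
    (X1 : team (D' `|` [set inl x]) M) (t : assignment D M) j :
  copies X t j -> (forall k, X1 (upd (j k) (inl x) a)) ->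
  copies X1 (upd t x a) (fun k => upd (j k) (inl x) a).
Proof.
move=> [_ jt fresh] X1j; split=> // [k|k k' E].
  by apply: agree_upd => //; exact: inl_inj.
by apply: fresh => n; have := E n; rewrite !value_upd_neq.
Qed.

Lemma fat_similar D' D (X : team D' M) (Y : team D M) :
  fat X Y -> similar inl X Y.
Proof.
move=> [XY YX]; split=> // t /YX[j [Xj jt _]].
by exists (j (fun=> default M)).
Qed.

(** For a disjunction the copies marked by [b0] go to the right-hand side and
    all the others to the left-hand side, when the assignment belongs to both.
    For an existential quantifier a copy is given the head of its sequence
    whenever this is an admissible value. *)
Lemma sat_strict_fat C (phi : formula tau C V) (a0 b0 : M) (D' : set (V + nat))
    (D : set V) (X : team D' M) (Y : team D M) :
  a0 <> b0 -> fat X Y -> fo_sat Lax phi Y -> fo_sat Strict (rename inl phi) X.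
Proof.
move=> ab; elim: phi D' D X Y;
  try by [move=> *; eapply sat_atomic;
    [apply: fat_similar; eassumption|exact: I|eassumption]].
- move=> psi IH1 chi IH2 D' D X Y XY /= [H1 H2].
  by split; [apply: IH1 H1|apply: IH2 H2].
- move=> psi IH1 chi IH2 D' D X Y [XY YX] /= [Y1 [Y2 [Y12 _ H1 H2]]].
  have sub1 t : Y1 t -> Y t by move=> ?; rewrite -Y12; left.
  have sub2 t : Y2 t -> Y t by move=> ?; rewrite -Y12; right.
  have [_|j Hj] := @choose_when_possible (assignment D M)
    (fun=> (nat -> M) -> assignment D' M) (fun t j => copies X t j).
    exact: inhabits (fun _ _ => default M).
  have {}Hj t : Y t -> copies X t (j t) by move/YX/Hj.
  (* The left-hand side; its complement keeps the copies marked by [b0] of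
     every assignment in [Y2]. *)
  pose X1 : team D' M := [set s | X s /\ exists t, [/\ Y1 t, agree inl s t &
    Y2 t -> ~ exists k, s = j t (prepend b0 k)]].
  exists X1, (X `\` X1); split.
  + apply/seteqP; split=> [s [[]|[]] //|s Xs].
    by have [?|?] := pselect (X1 s); [left|right].
  + by move=> _; rewrite setDIK.
  + apply: IH1 H1; split=> [s [_ [t [Y1t st _]]]|t Y1t]; first by exists t.
    have jt := Hj t (sub1 t Y1t); have [Xj agj _] := jt.
    exists (fun k => j t (prepend a0 k)); apply: (copies_prepend jt) => k.
    split=> //; exists t; split=> // _ [k' E].
    exact/ab/(copies_inj jt E).
  + apply: IH2 H2; split=> [s [Xs nX1s]|t Y2t].
      have [t Yt st] := XY s Xs; exists t => //.
      move: (Yt); rewrite -Y12 => -[Y1t|//].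
      have [//|nY2t] := pselect (Y2 t).
      by case: nX1s; split=> //; exists t.
    have jt := Hj t (sub2 t Y2t); have [Xj agj _] := jt.
    exists (fun k => j t (prepend b0 k)); apply: (copies_prepend jt) => k.
    split=> // -[_ [t' [_ /(agree_uniq (agj _)) <- nk]]].
    by apply: nk => //; exists k.
- move=> x psi IH D' D X Y [XY YX] /= [F [F0 _ H]].
  have [_|j Hj] := @choose_when_possible (assignment D M)
    (fun=> (nat -> M) -> assignment D' M) (fun t j => copies X t j).
    exact: inhabits (fun _ _ => default M).
  have {}Hj t : Y t -> copies X t (j t) by move/YX/Hj.
  (* Copies marked by an admissible value receive it, so that the copies marked
     by [b] remain when [b] becomes the value of [x]. *)
  have [s|f Hf] := @choose_when_possible (assignment D' M) (fun=> carrier M)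
    (fun s a => forall t, Y t -> agree inl s t -> F t a /\
      forall k b, F t b -> s = j t (prepend b k) -> a = b).
    exact: carrier_inhabited.
  have {}Hf s : X s -> forall t, Y t -> agree inl s t -> F t (f s) /\
      forall k b, F t b -> s = j t (prepend b k) -> f s = b.
    move=> Xs; apply: Hf; have [t Yt st] := XY s Xs.
    have [[k [a [Fa E]]]|nE] :=
        pselect (exists k a, F t a /\ s = j t (prepend a k)).
      exists a => t' _ /(agree_uniq st) <-; split=> // k' b _.
      by rewrite E; apply: copies_inj (Hj t Yt).
    have [a Fa] := F0 t Yt; exists a => t' _ /(agree_uniq st) <-; split=> //.
    by move=> k b Fb E; case: nE; exists k, b.
  exists (fun s => [set f s]); split.
  + by move=> s _; exists (f s).
  + by move=> _ s _; exists (f s).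
  + apply: IH H; split=> [_ [s [_ [Xs -> ->]]]|_ [t [b [Yt Fb ->]]]].
      have [t Yt st] := XY s Xs; have [Ff _] := Hf s Xs t Yt st.
      exists (upd t x (f s)); first by exists t, (f s).
      by apply: agree_upd => //; exact: inl_inj.
    have jt := Hj t Yt; have [Xj agj _] := jt.
    have jtb := copies_prepend jt (fun k => Xj (prepend b k)).
    exists (fun k => upd (j t (prepend b k)) (inl x) b).
    apply: (copies_upd jtb) => k; exists (j t (prepend b k)), b; split=> //.
    have [_ Hb] := Hf _ (Xj (prepend b k)) t Yt (agj _).
    by rewrite /= (Hb k b).
- move=> x psi IH D' D X Y [XY YX] /=; apply: IH.
  split=> [_ [s [a [Xs ->]]]|_ [t [a [Yt ->]]]].
    have [t Yt st] := XY s Xs; exists (upd t x a); first by exists t, a.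
    by apply: agree_upd => //; exact: inl_inj.
  have [j jt] := YX t Yt; have [Xj _ _] := jt.
  exists (fun k => upd (j k) (inl x) a).
  by apply: (copies_upd jt) => k; exists (j k), a.
Qed.

(** The fresh variables [inr n] take all values independently of [Y]. *)
Definition fattening (Y : team [set: V] M) : team [set: V + nat] M :=
  [set s | exists2 t, Y t & agree inl s t].

Lemma fat_fattening (Y : team [set: V] M) : fat (fattening Y) Y.
Proof.
split=> // t Yt.
pose j (k : nat -> M) : assignment [set: V + nat] M := fun y =>
  match val y with inl x => value t x | inr n => k n end.
have jE k y :
    value (j k) y = match y with inl x => value t x | inr n => k n end.
  exact: (value_total (fun y =>
    match y with inl x => value t x | inr n => k n end)).
exists j; split=> [k|k x|k k' E]; last 2 first.
- by rewrite jE.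
- by apply: funext => n; have := E n; rewrite !jE.
by exists t => // x; rewrite jE.
Qed.

End FatTeams.

Lemma sat_empty (tau : signature) (M : structure tau) (C : set atom) V m
    (phi : formula tau C V) (D : set V) :
  fo_sat m phi (set0 : team D M).
Proof.
elim: phi D => //=.
- move=> psi IH1 chi IH2 D; exists set0, set0.
  by split=> //; rewrite ?setU0 ?setI0.
- move=> x psi IH D; exists (fun=> set0); split=> //.
  rewrite (_ : team_supp _ _ _ = set0); first exact: IH.
  by apply/seteqP; split=> // t [s [a []]].
- move=> x psi IH D.
  rewrite (_ : team_dupl _ _ = set0); first exact: IH.
  by apply/seteqP; split=> // t [s [a []]].
Qed.

(** With one element there are no copies to distribute, but also at most one
    assignment: a strict split can put all of it on a side that is inhabited
    in the lax split. *)
Lemma sat_strict_subsingleton (tau : signature) (M : structure tau)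
    (C : set atom) V V' (r : V -> V') (phi : formula tau C V) (D' : set V')
    (D : set V) (X : team D' M) (Y : team D M) :
  (forall a b : M, a = b) -> X !=set0 -> Y !=set0 ->
  fo_sat Lax phi Y -> fo_sat Strict (rename r phi) X.
Proof.
move=> sub.
have sim (E' : set V') (E : set V) (X0 : team E' M) (Y0 : team E M) :
    X0 !=set0 -> Y0 !=set0 -> similar r X0 Y0.
  by move=> [s Xs] [t Yt]; split=> ? _; [exists t|exists s] => // x.
elim: phi D' D X Y; try by [move=> *; eapply sat_atomic;
    [apply: sim; eassumption|exact: I|eassumption]].
- move=> psi IH1 chi IH2 D' D X Y X0 Y0 /= [H1 H2].
  by split; [apply: IH1 H1|apply: IH2 H2].
- move=> psi IH1 chi IH2 D' D X Y X0 [t Yt] /= [Y1 [Y2 [Y12 _ H1 H2]]].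
  move: Yt; rewrite -Y12 => -[Yt|Yt].
    exists X, set0; split; rewrite ?setU0 ?setI0 //; last exact: sat_empty.
    by apply: IH1 H1 => //; exists t.
  exists set0, X; split; rewrite ?set0U ?set0I //; first exact: sat_empty.
  by apply: IH2 H2 => //; exists t.
- move=> x psi IH D' D X Y [s Xs] [t Yt] /= [F [F0 _ H]].
  exists (fun=> [set default M]); split.
  + by move=> ? _; exists (default M).
  + by move=> _ ? _; exists (default M).
  + apply: IH H; first by exists (upd s (r x) (default M)), s, (default M).
    by have [a Fa] := F0 t Yt; exists (upd t x a), t, a.
- move=> x psi IH D' D X Y [s Xs] [t Yt] /= H; apply: IH H.
    by exists (upd s (r x) (default M)), s, (default M).
  by exists (upd t x (default M)), t, (default M).
Qed.

(** * Compactness of first-order logic with dependency atoms *)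

(** The team is pulled back along [r] to the full domain [V], so that all finite
    subsets of [Gamma] are satisfied by teams with one common domain. *)
Lemma lax_total_of_rename (tau : signature) (C : set atom) (V V' : Type)
    (r : V -> V') m (Gamma : set (formula tau C V)) :
  injective r -> satisfiable (L := FO tau C m V') (rename r @` Gamma) ->
  satisfiable_on (L := FO tau C Lax V) [set: V] Gamma.
Proof.
move=> r_inj [D [_ [M [X [[s Xs] HX]]]]]; split=> //.
pose forget (s : assignment D M) : assignment [set: V] M :=
  fun y => value s (r (val y)).
have forgetE s' : agree r s' (forget s').
  by move=> x; rewrite (value_total (fun x => value s' (r x))).
exists M, (forget @` X); split; first by exists (forget s), s.
move=> phi Gphi /=.
apply: (sat_lax_of_rename (X := X) r_inj); last by apply: HX; exists phi.
split=> [s' Xs'|_ [s' Xs' <-]]; last by exists s'.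
by exists (forget s') => //; exists s'.
Qed.

Lemma strict_unbounded_of_lax (tau : signature) (C : set atom) (V : Type)
    (Gamma : set (formula tau C V)) :
  satisfiable_on (L := FO tau C Lax V) [set: V] Gamma ->
  satisfiable_unbounded Strict Gamma.
Proof.
move=> [_ [M [Y [[t Yt] HY]]]].
exists (V + nat)%type, inl; split; first exact: inl_inj.
exists setT; split=> //; exists M, (fattening Y).
have fatY := fat_fattening Y.
have X0 : fattening Y !=set0.
  by have [s Xs _] := (fat_similar fatY).2 t Yt; exists s.
split=> // _ [phi Gphi <-] /=.
have [[a [b ab]]|nab] := pselect (exists a b : M, a <> b).
  exact: sat_strict_fat ab fatY (HY phi Gphi).
apply: (sat_strict_subsingleton inl _ X0 _ (HY phi Gphi)); last by exists t.
by move=> a b; apply: contrapT => ab; apply: nab; exists a, b.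
Qed.

Theorem theorem3p14 (tau : signature) (V : Type) :
  (forall L : team_logic tau V, has_los L ->
     forall D : set V, compact_for (satisfiable_on (L := L) D)) /\
  (forall C : set atom,
     compact_for (satisfiable (L := FO tau C Lax V)) /\
     compact_for (@satisfiable_unbounded tau C Strict V)).
Proof.
split=> [L los D|C]; first exact: los_compact.
have lax_compact := los_compact (@lax_los tau C V) (D := [set: V]).
split=> Gamma fin_sat.
  exists [set: V]; apply: lax_compact => A finA AG.
  apply: (@lax_total_of_rename _ _ _ _ id Lax) => //.
  rewrite (_ : _ @` _ = A); first exact: fin_sat.
  by apply/seteqP; split=> [_ [phi Aphi <-]|phi Aphi]; rewrite ?rename_id //;
    exists phi; rewrite ?rename_id.
apply: strict_unbounded_of_lax; apply: lax_compact => A finA AG.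
have [V' [r [r_inj sat_A]]] := fin_sat A finA AG.
exact: lax_total_of_rename sat_A.
Qed.
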